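(* Let $\mathbb{X}$ be a real ordered vector space, $x,y\in\mathbb{X}$ with $x\le y$, and let $\mathbb{Y}$ be an absolute order unit space having vector lattice structure which is Dedekind complete. Let $\mathcal{BV}$ be the space of all functions $f:[x,y]\to\mathbb{Y}$ of bounded variation, and for $f\in\mathcal{BV}$ write $\|f\|_{\mathcal{BV}}=\big\||f(x)|+\mathcal{V}(f)\big\|$, where $\|\cdot\|$ is the order unit norm of $\mathbb{Y}$. Then $(\mathcal{BV},\|\cdot\|_{\mathcal{BV}})$ is a normed space. Moreover, for $f,g\in\mathcal{BV}$: (1) $\|f\|_{\mathcal{BV}}=\big\||f(x)|+\mathcal{V}_f\big\|_0$. (2) $\|f\|_0\le\|f\|_{\mathcal{BV}}$. (3) If $\mathbb{Y}$ is order complete, then $(\mathcal{BV},\|\cdot\|_{\mathcal{BV}})$ is complete. (4) If $|f|_{\mathcal V}\le|g|_{\mathcal V}$ (pointwise), then $\|f\|_{\mathcal{BV}}\le\|g\|_{\mathcal{BV}}$. (5) $\|f\dot\vee g\|_0\le\|f\|_{\mathcal{BV}}+\|g\|_{\mathcal{BV}}$ for all $f,g\in\mathcal{BV}^+$. In this case, $(\mathcal{BV},\|\cdot\|_{\mathcal{BV}})$, ordered by $\mathcal{BV}_0^+$, is an ordered normed space.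
   Context: A real ordered vector space is a real vector space $\mathbb{V}$ with a cone $\mathbb{V}^+$ (non-empty, closed under addition and under multiplication by non-negative reals); $u\le v$ means $v-u\in\mathbb{V}^+$, and $u<v$ means $u\le v$ and $u\neq v$. An ordered normed space is a real ordered vector space equipped with a norm. For $a\le b$ in $\mathbb{X}$, $[a,b]=\{w\in\mathbb{X}: a\le w\le b\}$. A partition $\mathcal{P}$ of $[a,b]$ is a finite chain $a=x_0<x_1<\cdots<x_{n_{\mathcal P}}=b$ of points of $[a,b]$ (if $a=b$ this is the single point and the sum below is $0$). A function $f$ on $[a,b]$ with values in $\mathbb{Y}$ is of bounded variation on $[a,b]$ if $\mathcal{V}(f,a,b)=\sup\{\sum_{i=1}^{n_{\mathcal P}}|f(x_i)-f(x_{i-1})|:\mathcal P \text{ a partition of }[a,b]\}$ exists in $\mathbb{Y}$; $\mathcal{V}(f)=\mathcal{V}(f,x,y)$. For $f\in\mathcal{BV}$ (with $\mathbb{Y}$ a Dedekind complete vector lattice) $f$ is of bounded variation on $[x,z]$ for every $z\in[x,y]$; the variation function is $\mathcal{V}_f(z)=\mathcal{V}(f,x,z)$, and $|f|_{\mathcal V}$ is the function $z\mapsto|f(x)|+\mathcal{V}_f(z)$. $\mathcal{BV}^+=\{f\in\mathcal{BV}:f([x,y])\subseteq\mathbb{Y}^+\}$; $\mathcal{BV}_0^+$ is the set of $f\in\mathcal{BV}^+$ that are monotonically increasing ($z_1\le z_2\Rightarrow f(z_1)\le f(z_2)$). $f\dot\vee g=\frac12(f+g+|f-g|_{\mathcal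 V})$. $\|\cdot\|_0$ is the order unit norm on $\mathcal{BV}$, with cone $\mathcal{BV}^+$, determined by the constant function $f_0=e$ ($e$ the order unit of $\mathbb{Y}$): $\|f\|_0=\inf\{\epsilon>0:\epsilon f_0\pm f\in\mathcal{BV}^+\}=\sup_{z\in[x,y]}\|f(z)\|$. An absolutely ordered space is a real ordered vector space $(\mathbb{V},\mathbb{V}^+)$ with a map $|\cdot|:\mathbb{V}\to\mathbb{V}^+$ such that: (a) $|u|=u$ for $u\in\mathbb{V}^+$; (b) $|u|\pm u\in\mathbb{V}^+$ for all $u$; (c) $|\alpha u|=|\alpha||u|$ for all $u\in\mathbb{V},\alpha\in\mathbb{R}$; (d) if $|u-v|=u+v$ and $0\le w\le v$, then $|u-w|=u+w$; (e) if $|u-v|=u+v$ and $|u-w|=u+w$, then $\big|u-|v\pm w|\big|=u+|v\pm w|$. An element $e\in\mathbb{V}^+$ is an order unit if for each $v$ there is $\epsilon>0$ with $\epsilon e\pm v\in\mathbb{V}^+$; when $\mathbb{V}^+$ is proper ($\mathbb{V}^+\cap-\mathbb{V}^+=\{0\}$) and Archimedean ($\epsilon w+v\in\mathbb{V}^+$ for all $\epsilon>0$ and a fixed $w\in\mathbb{V}^+$ implies $v\in\mathbb{V}^+$), the order unit norm is $\|v\|=\inf\{\epsilon>0:\epsilon e\pm v\in\mathbb{V}^+\}$. For $u,v\in\mathbb{V}^+$: $u\perp v$ means $|u-v|=u+v$; $u\perp_\infty v$ means $\|\alpha u+\beta v\|=\max\{\|\alpha u\|,\|\beta v\|\}$ for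 all real $\alpha,\beta$; $u\perp_\infty^a v$ means $u_1\perp_\infty v_1$ whenever $0\le u_1\le u$, $0\le v_1\le v$. An absolute order unit space is an absolutely ordered space with an order unit norm determined by an order unit $e$, norm-closed $\mathbb{V}^+$, and $\perp=\perp_\infty^a$ on $\mathbb{V}^+$. ''Having vector lattice structure'' means $\mathbb{Y}$ is a vector lattice with $|u|=u\vee(-u)$; it is Dedekind complete if every non-empty subset that is bounded above has a supremum. ''Order complete'' is taken in its standard meaning for vector lattices: every non-empty order bounded subset has a supremum and an infimum.
   Formalization: The convention that a partition of [a,b] with a=b is a single point is dropped when the cone of X is not proper: chains a<c<a are then allowed, since otherwise for x=y the variation vanishes and ‖f‖_BV is not a norm; for proper cones nothing changes. *)

(* Defs.v *)
From HB Require Import structures.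
From mathcomp Require Import all_boot all_order all_algebra.
From mathcomp Require Import boolp classical_sets functions reals.

Set Implicit Arguments.
Unset Strict Implicit.
Unset Printing Implicit Defensive.

Import Order.TTheory GRing.Theory Num.Theory.

Local Open Scope classical_set_scope.
Local Open Scope ring_scope.

Section Cones.
Context {R : realType} {V : lmodType R}.
Implicit Types (C S : set V) (e u v w : V) (N : V -> R).

Definition is_cone C : Prop :=
  [/\ C !=set0,
      forall u v, C u -> C v -> C (u + v) &
      forall (a : R) u, 0 <= a -> C u -> C (a *: u)].

Definition proper_cone C : Prop := forall v, C v -> C (- v) -> v = 0.

Definition archimedean_cone C : Prop :=
  forall w v, C w -> (forall eps : R, 0 < eps -> C (eps *: w + v)) -> C v.

Definition order_unit C e : Prop :=
  C e /\ forall v, exists eps : R,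
    [/\ 0 < eps, C (eps *: e + v) & C (eps *: e - v)].

Definition order_unit_norm C e v : R :=
  inf [set eps : R | [/\ 0 < eps, C (eps *: e + v) & C (eps *: e - v)]].

Definition norm_closed N C : Prop :=
  forall v, (forall eps : R, 0 < eps -> exists2 u, C u & N (v - u) < eps) -> C v.

Definition is_subspace S : Prop :=
  [/\ S 0,
      forall u v, S u -> S v -> S (u + v) &
      forall (a : R) u, S u -> S (a *: u)].

Definition is_norm_on S N : Prop :=
  [/\ forall u, S u -> 0 <= N u,
      forall u, S u -> N u = 0 -> u = 0,
      forall (a : R) u, S u -> N (a *: u) = `|a| * N u &
      forall u v, S u -> S v -> N (u + v) <= N u + N v].

Definition normed_space S N : Prop := is_subspace S /\ is_norm_on S N.

Definition complete_space S N : Prop :=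
  forall u_ : nat -> V, (forall n, S (u_ n)) ->
    (forall eps : R, 0 < eps -> exists n0 : nat, forall m n : nat,
       (n0 <= m)%N -> (n0 <= n)%N -> N (u_ m - u_ n) < eps) ->
    exists2 l : V, S l & forall eps : R, 0 < eps ->
      exists n0 : nat, forall n : nat, (n0 <= n)%N -> N (u_ n - l) < eps.

Definition ordered_normed_space S N C : Prop :=
  [/\ normed_space S N, C `<=` S & is_cone C].

End Cones.

HB.mixin Record isOrderedVect (R : realType) V of GRing.Lmodule R V := {
  vpos : set V;
  vpos_cone : is_cone vpos
}.

(* The cone is not assumed to be proper, so [vle] is only a preorder here. *)
#[short(type="orderedVectType")]
HB.structure Definition OrderedVect (R : realType) :=
  { V of isOrderedVect R V & GRing.Lmodule R V }.

Section Order.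
Context {R : realType} {V : orderedVectType R}.
Implicit Types (u v w s : V) (S : set V).

Definition vle u v : Prop := vpos (v - u).
Definition vlt u v : Prop := vle u v /\ u <> v.

Definition vitv u v : set V := [set w | vle u w /\ vle w v].

Definition is_supremum S s : Prop :=
  (forall u, S u -> vle u s) /\
  (forall b, (forall u, S u -> vle u b) -> vle s b).

Definition is_infimum S s : Prop :=
  (forall u, S u -> vle s u) /\
  (forall b, (forall u, S u -> vle b u) -> vle b s).

Lemma vle_refl u : vle u u.
Proof.
rewrite /vle subrr; have [[w Cw] _ CZ] := @vpos_cone R V.
by rewrite -(scale0r w); apply: CZ.
Qed.

Lemma vitv_left_subproof u v : vle u v -> u \in vitv u v.
Proof. by move=> uv; apply/mem_set; split=> //; apply: vle_refl. Qed.

Lemma vitv_right_subproof u v : vle u v -> v \in vitv u v.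
Proof. by move=> uv; apply/mem_set; split=> //; apply: vle_refl. Qed.

Definition vitv_left u v (uv : vle u v) : vitv u v :=
  exist _ u (vitv_left_subproof uv).

Definition vitv_right u v (uv : vle u v) : vitv u v :=
  exist _ v (vitv_right_subproof uv).

End Order.

HB.mixin Record isAbsOrdered (R : realType) V of OrderedVect R V := {
  vabs : V -> V;
  vabs_pos : forall u, vpos (vabs u);
  vabs_id : forall u : V, vpos u -> vabs u = u;
  vabs_pm : forall u, vpos (vabs u + u) /\ vpos (vabs u - u);
  vabsZ : forall (a : R) u, vabs (a *: u) = `|a| *: vabs u;
  vabs_orth_le : forall u v w : V,
    vabs (u - v) = u + v -> vle 0 w -> vle w v -> vabs (u - w) = u + w;
  vabs_orth_abs : forall u v w : V,
    vabs (u - v) = u + v -> vabs (u - w) = u + w ->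
    vabs (u - vabs (v + w)) = u + vabs (v + w) /\
    vabs (u - vabs (v - w)) = u + vabs (v - w)
}.

#[short(type="absOrderedType")]
HB.structure Definition AbsOrdered (R : realType) :=
  { V of isAbsOrdered R V & OrderedVect R V }.

Section Orthogonality.
Context {R : realType} {V : absOrderedType R}.
Implicit Types (e u v : V).

Definition orth u v : Prop := vabs (u - v) = u + v.

Definition orth_infty e u v : Prop :=
  forall a b : R,
    order_unit_norm vpos e (a *: u + b *: v) =
    Num.max (order_unit_norm vpos e (a *: u)) (order_unit_norm vpos e (b *: v)).

Definition orth_infty_a e u v : Prop :=
  forall u1 v1 : V, vle 0 u1 -> vle u1 u -> vle 0 v1 -> vle v1 v ->
    orth_infty e u1 v1.

End Orthogonality.

HB.mixin Record isAbsOrderUnit (R : realType) V of AbsOrdered R V := {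
  vunit : V;
  vunit_order_unit : order_unit vpos vunit;
  vpos_proper : proper_cone (vpos : set V);
  vpos_archimedean : archimedean_cone (vpos : set V);
  vpos_closed : norm_closed (order_unit_norm vpos vunit) vpos;
  orth_iff : forall u v : V, vpos u -> vpos v ->
    (orth u v <-> orth_infty_a vunit u v)
}.

#[short(type="absOrderUnitType")]
HB.structure Definition AbsOrderUnit (R : realType) :=
  { V of isAbsOrderUnit R V & AbsOrdered R V }.

Definition unorm {R : realType} {Y : absOrderUnitType R} (v : Y) : R :=
  order_unit_norm vpos vunit v.

(* Antisymmetry of [vle], part of being a lattice, comes from [vpos_proper]. *)
Definition vector_lattice {R : realType} (Y : absOrderUnitType R) : Prop :=
  (forall u v : Y, (exists s, is_supremum [set u; v] s) /\
                   (exists s, is_infimum [set u; v] s)) /\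
  (forall u : Y, is_supremum [set u; - u] (vabs u)).

Definition dedekind_complete {R : realType} (Y : orderedVectType R) : Prop :=
  forall S : set Y, S !=set0 -> (exists b, forall u, S u -> vle u b) ->
    exists s, is_supremum S s.

Definition order_complete {R : realType} (Y : orderedVectType R) : Prop :=
  forall S : set Y, S !=set0 -> (exists a b, S `<=` vitv a b) ->
    (exists s, is_supremum S s) /\ (exists s, is_infimum S s).

Section BoundedVariation.
Context {R : realType} {X : orderedVectType R} {Y : absOrderUnitType R}.
Context {x y : X}.
Implicit Types (f g : vitv x y -> Y) (a b z : vitv x y).

(* [t 0 < t 1 < ... < t n] is a partition of [a, b]: its points lie between  *)
(* [a] and [b] by transitivity. The case [n = 0] forces [a = b]; conversely  *)
(* [a = b] forces [n = 0] when the cone of [X] is proper. When it is not,    *)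
(* chains may go back and forth between order-equivalent points; without     *)
(* them, the variation would not separate such points.                       *)
Definition is_partition a b (n : nat) (t : nat -> vitv x y) : Prop :=
  [/\ t 0%N = a, t n = b &
      forall i : nat, (i < n)%N -> vlt (val (t i)) (val (t i.+1))].

Definition variation_sums f a b : set Y :=
  [set s | exists (n : nat) (t : nat -> vitv x y),
     is_partition a b n t /\ s = \sum_(i < n) vabs (f (t i.+1) - f (t i))].

Definition bounded_variation f a b : Prop :=
  exists v, is_supremum (variation_sums f a b) v.

(* The supremum, unique since the cone of [Y] is proper; 0 by default. *)
Definition variation f a b : Y :=
  xget 0 [set v | is_supremum (variation_sums f a b) v].

Variable hxy : vle x y.
Let x0 := vitv_left hxy.
Let y0 := vitv_right hxy.

Definition BV : set (vitv x y -> Y) := [set f | bounded_variation f x0 y0].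

Definition BVpos : set (vitv x y -> Y) :=
  [set f | BV f /\ forall z, vpos (f z)].

Definition BVpos0 : set (vitv x y -> Y) :=
  [set f | BVpos f /\
     forall z1 z2, vle (val z1) (val z2) -> vle (f z1) (f z2)].

Definition total_variation f : Y := variation f x0 y0.

Definition variation_fun f : vitv x y -> Y := fun z => variation f x0 z.

Definition abs_var f : vitv x y -> Y := fun z => vabs (f x0) + variation_fun f z.

Definition dot_join f g : vitv x y -> Y := 2^-1 *: (f + g + abs_var (f - g)).

Definition norm0 f : R := order_unit_norm BVpos (cst (vunit : Y)) f.

Definition normBV f : R := unorm (vabs (f x0) + total_variation f).

End BoundedVariation.

(* Main.v *)
Require Import Defs.
From HB Require Import structures.
From mathcomp Require Import all_boot all_order all_algebra.
From mathcomp Require Import boolp classical_sets functions reals.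

(** The whole argument goes through one elementary reformulation of the norm.
    In an Archimedean order unit space the gauge of [v >= 0] is at most [c] iff
    [v <= c e] ([unorm_le]), and a supremum is below [w] iff every member is.
    Hence [N f <= c] says exactly that

      [|f x| + s <= c e] for every variation sum [s] of [f] over [[x, y]]

    ([normBV_le], [normBVP]). Suprema have disappeared from this condition, so
    every property of [N] reduces to a property of finite sums of absolute
    values along one fixed chain. By Dedekind completeness the condition, for
    some [c], also characterizes membership in BV ([normBV_le_BV]), so that a
    single estimate gives both membership and a norm bound.

    Sums, multiples and pointwise limits preserve the condition
    ([normBV_leD], [normBV_leZ], [normBV_le_lim]): this gives the normed space
    axioms and, a chain being finite, the passage to the limit in
    completeness. The chain [x <= z <= y] gives [|f z| <= N f e]
    ([normBV_le_value]), hence definiteness, the comparison with the sup norm,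
    and the existence of the pointwise limit of a Cauchy sequence; that limit
    exists because an order unit space in which bounded sets have suprema is
    norm complete ([cauchy_ucvg]).

    Extending a chain from [z1] to [z2] can only add to its sum, so the function
    [|f x| + V_f] increases. Its variation sums telescope, which puts it in
    BV, and its largest value is the one at [y], which is the element whose
    norm defines [N f] ([normBV_abs_var]). The statements comparing [N] with the
    sup norm follow by evaluating at [y]. *)

Set Implicit Arguments.
Unset Strict Implicit.
Unset Printing Implicit Defensive.

Import Order.TTheory GRing.Theory Num.Theory.

Local Open Scope classical_set_scope.
Local Open Scope ring_scope.

(** * Ordered vector spaces *)

Section OrderTheory.
Context {R : realType} {V : orderedVectType R}.
Implicit Types (e u v w s : V) (a b : R).

Lemma vposE u : vpos u = vle 0 u.
Proof. by rewrite /vle subr0. Qed.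

Lemma vposD u v : vpos u -> vpos v -> vpos (u + v).
Proof. by have [_ CD _] := @vpos_cone R V; apply: CD. Qed.

Lemma vposZ a u : 0 <= a -> vpos u -> vpos (a *: u).
Proof. by have [_ _ CZ] := @vpos_cone R V; apply: CZ. Qed.

Lemma vle_trans v u w : vle u v -> vle v w -> vle u w.
Proof. by rewrite /vle => uv vw; rewrite -(subrKA v); apply: vposD. Qed.

Lemma vleD u v w s : vle u v -> vle w s -> vle (u + w) (v + s).
Proof. by rewrite /vle => uv ws; rewrite opprD addrACA; apply: vposD. Qed.

Lemma vleZ a u v : 0 <= a -> vle u v -> vle (a *: u) (a *: v).
Proof. by rewrite /vle => a0 uv; rewrite -scalerBr; apply: vposZ. Qed.

Lemma vleZl e a b : vpos e -> a <= b -> vle (a *: e) (b *: e).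
Proof.
rewrite /vle => e0 ab; rewrite -scalerBl.
by apply: vposZ => //; rewrite subr_ge0.
Qed.

Lemma vle_subl u v w : vle (u - w) v = vle u (v + w).
Proof. by rewrite /vle opprB addrA. Qed.

Lemma vle_subr u v w : vle u (v - w) = vle (u + w) v.
Proof. by rewrite /vle -addrA -opprD [w + u]addrC. Qed.

Lemma vle_addr u v : vpos v -> vle u (u + v).
Proof. by rewrite /vle addrAC subrr add0r. Qed.

Lemma vle_sum n (F G : 'I_n -> V) :
  (forall i, vle (F i) (G i)) -> vle (\sum_i F i) (\sum_i G i).
Proof.
by move=> FG; apply: (big_ind2 vle) => // *; [apply: vle_refl|apply: vleD].
Qed.

Lemma is_supremum_le (S : set V) s v :
  is_supremum S s -> vle s v <-> forall u, S u -> vle u v.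
Proof.
move=> [Ss sle]; split=> [sv u Su|]; last exact: sle.
exact: vle_trans (Ss u Su) sv.
Qed.

End OrderTheory.

(** * The gauge of an order unit *)

Section Gauge.
Context {R : realType} {V : lmodType R}.
Variables (C : set V) (e : V).
Hypothesis coneC : is_cone C.
Implicit Types (v : V) (c : R).

Lemma order_unit_norm_ge0 v : 0 <= order_unit_norm C e v.
Proof.
rewrite /order_unit_norm; set S := (X in inf X).
have [->|S0] := eqVneq S set0; first by rewrite inf0.
by apply: lb_le_inf => [|c [/ltW]]; first exact/set0P.
Qed.

Lemma order_unit_norm_le v c :
  C e -> 0 <= c -> C (c *: e + v) -> C (c *: e - v) ->
  order_unit_norm C e v <= c.
Proof.
have [_ CD CZ] := coneC => Ce c0 cDv cBv.
apply/ler_addgt0Pl => d d0; apply: ge_inf.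
  by exists 0 => b [/ltW].
split; first by rewrite ltr_wpDr.
  by rewrite scalerDl -addrA; apply: CD => //; apply: CZ => //; apply: ltW.
by rewrite scalerDl -addrA; apply: CD => //; apply: CZ => //; apply: ltW.
Qed.

(** The Archimedean property makes the infimum defining the gauge attained. *)
Lemma order_unit_norm_attained v : archimedean_cone C -> order_unit C e ->
  C (order_unit_norm C e v *: e + v) /\ C (order_unit_norm C e v *: e - v).
Proof.
have [_ CD CZ] := coneC => archC [Ce unite]; set c := order_unit_norm C e v.
pose bound b := C (b *: e + v) /\ C (b *: e - v).
have near d : 0 < d -> exists b, b < c + d /\ bound b.
  move=> d0.
  pose S := [set b : R | [/\ 0 < b, C (b *: e + v) & C (b *: e - v)]].
  have infS : has_inf S.
    split; first by have [b] := unite v; exists b.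
    by exists 0 => b [/ltW].
  by have [b [_ bD bB] bc] := inf_adherent d0 infS; exists b.
by split; apply: (archC e) => // d /near[b [bc [bD bB]]];
  rewrite addrA -scalerDl -(subrK b (d + c)) scalerDl -addrA;
  apply: CD => //; apply: CZ => //; rewrite subr_ge0 addrC ltW.
Qed.

End Gauge.

(** * Order unit vector lattices *)

Section Lattice.
Context {R : realType} {Y : absOrderUnitType R}.
Local Notation e := (vunit : Y).
Implicit Types (u v w : Y) (a b c d : R).

Lemma vunit_pos : vpos e.
Proof. by case: (@vunit_order_unit R Y). Qed.

Lemma vle_unit a b : a <= b -> vle (a *: e) (b *: e).
Proof. by apply: vleZl; apply: vunit_pos. Qed.

(** The Archimedean property, as an epsilon of room. *)
Lemma vle_eps u v : (forall d, 0 < d -> vle u (v + d *: e)) -> vle u v.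
Proof.
move=> uv; refine (@vpos_archimedean R Y e (v - u) vunit_pos _) => d.
move=> /uv; rewrite /vle.
by rewrite addrA [_ *: _ + v]addrC.
Qed.

Lemma unorm_le v c : vpos v -> 0 <= c -> unorm v <= c <-> vle v (c *: e).
Proof.
move=> v0 c0; split=> [vc|vc].
  have [_] := order_unit_norm_attained vpos_cone v vpos_archimedean
    vunit_order_unit.
  by move=> /vle_trans; apply; apply: vle_unit.
apply: order_unit_norm_le => //; first exact: vpos_cone.
- exact: vunit_pos.
- by apply: vposD => //; apply: vposZ => //; apply: vunit_pos.
Qed.

Lemma vabs0 : vabs (0 : Y) = 0.
Proof. by rewrite vabs_id // vposE; apply: vle_refl. Qed.

Lemma vle_vabs u : vle u (vabs u).
Proof. by case: (vabs_pm u). Qed.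

Lemma vleN_vabs u : vle (- u) (vabs u).
Proof. by rewrite /vle opprK; case: (vabs_pm u). Qed.

Lemma vabsN u : vabs (- u) = vabs u.
Proof. by rewrite -scaleN1r vabsZ normrN1 scale1r. Qed.

Lemma vabs_dist u v w : vle (vabs (u - v)) w -> vle u (v + w) /\ vle v (u + w).
Proof.
move=> uvw; split; rewrite addrC -vle_subl; apply: vle_trans uvw.
  exact: vle_vabs.
by rewrite -opprB; apply: vleN_vabs.
Qed.

(** Properness of the cone enters through this lemma: it is what makes the norm
    of BV definite. *)
Lemma vabs_le0 u : vle (vabs u) 0 -> u = 0.
Proof.
move=> u0; apply: vpos_proper; rewrite vposE.
  rewrite -(opprK u) -sub0r vle_subr add0r.
  exact: vle_trans (vleN_vabs u) u0.
by rewrite -sub0r vle_subr add0r; apply: vle_trans (vle_vabs u) u0.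
Qed.

Hypothesis hlat : vector_lattice Y.

Lemma vabs_le u v : vle u v -> vle (- u) v -> vle (vabs u) v.
Proof.
by move=> uv Nuv; have [_ sup_abs] := hlat; have [_] := sup_abs u;
  apply=> w [->|->].
Qed.

Lemma vabsD u v : vle (vabs (u + v)) (vabs u + vabs v).
Proof.
apply: vabs_le; rewrite ?opprD; apply: vleD;
  by [apply: vle_vabs|apply: vleN_vabs].
Qed.

End Lattice.

(** * Limits in the order unit norm *)

Section Limits.
Context {R : realType} {Y : absOrderUnitType R}.
Local Notation e := (vunit : Y).
Implicit Types (u v w : Y) (c d : R).

(** Convergence in the order unit norm, in terms of the order only. *)
Definition ucvg (u_ : nat -> Y) u : Prop := forall d, 0 < d ->
  exists n0, forall m, (n0 <= m)%N -> vle (vabs (u - u_ m)) (d *: e).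

(** This is [u <= liminf u_], phrased without the lower limit itself, which need
    not exist. *)
Definition le_liminf u (u_ : nat -> Y) : Prop := forall d, 0 < d ->
  exists n0, forall m, (n0 <= m)%N -> vle u (u_ m + d *: e).

Lemma le_liminfD u v (u_ v_ : nat -> Y) : le_liminf u u_ -> le_liminf v v_ ->
  le_liminf (u + v) (fun m => u_ m + v_ m).
Proof.
move=> uu vv d d0; have d20 : 0 < d / 2 by rewrite divr_gt0.
have [[nu un] [nv vn]] := (uu _ d20, vv _ d20).
exists (maxn nu nv) => m; rewrite geq_max => /andP[/un um /vn vm].
by rewrite [d]splitr scalerDl addrACA; apply: vleD.
Qed.

Lemma le_liminf_le u (u_ : nat -> Y) v : le_liminf u u_ ->
  (exists n0, forall m, (n0 <= m)%N -> vle (u_ m) v) -> vle u v.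
Proof.
move=> uu [nv vn]; apply: vle_eps => d /uu[nu un].
apply: vle_trans (un (maxn nu nv) (leq_maxl _ _)) _.
by apply: vleD; [apply/vn/leq_maxr|apply: vle_refl].
Qed.

Lemma le_liminf_sum n (F : 'I_n -> Y) (F_ : 'I_n -> nat -> Y) :
  (forall i, le_liminf (F i) (F_ i)) ->
  le_liminf (\sum_i F i) (fun m => \sum_i F_ i m).
Proof.
elim: n F F_ => [F F_ _|n IH F F_ FF] d d0.
  exists 0%N => m _; rewrite !big_ord0 add0r -vposE.
  by apply: vposZ; [apply: ltW|apply: vunit_pos].
have [n0 n0P] := le_liminfD (FF ord0) (IH _ _ (fun i => FF (lift ord0 i))) d0.
by exists n0 => m /n0P; rewrite !big_ord_recl.
Qed.

Section LatticeLimits.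
Hypothesis hlat : vector_lattice Y.

Lemma ucvg_cst u : ucvg (fun=> u) u.
Proof.
move=> d d0; exists 0%N => m _; rewrite subrr vabs0 -vposE.
by apply: vposZ; [apply: ltW|apply: vunit_pos].
Qed.

Lemma ucvgB (u_ v_ : nat -> Y) u v : ucvg u_ u -> ucvg v_ v ->
  ucvg (fun m => u_ m - v_ m) (u - v).
Proof.
move=> uu vv d d0; have d20 : 0 < d / 2 by rewrite divr_gt0.
have [[nu un] [nv vn]] := (uu _ d20, vv _ d20).
exists (maxn nu nv) => m; rewrite geq_max => /andP[/un um /vn vm].
rewrite opprD addrACA -opprD [d]splitr scalerDl.
by apply: vle_trans (vabsD hlat _ _) _; rewrite vabsN; apply: vleD.
Qed.

Lemma le_liminf_vabs (u_ : nat -> Y) u : ucvg u_ u ->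
  le_liminf (vabs u) (fun m => vabs (u_ m)).
Proof.
move=> uu d /uu[n0 n0P]; exists n0 => m /n0P um.
rewrite -[X in vabs X](subrKC (u_ m)); apply: vle_trans (vabsD hlat _ _) _.
by apply: vleD => //; apply: vle_refl.
Qed.

(** The limit is the lower limit, built as the supremum of the eventual lower
    bounds: for large [n] the element [u_ n - d e] is such a bound, and every
    such bound is below [u_ n + d e]. *)
Lemma cauchy_ucvg (hded : dedekind_complete Y) (u_ : nat -> Y) :
  (forall d, 0 < d -> exists n0, forall m n, (n0 <= m)%N -> (n0 <= n)%N ->
     vle (vabs (u_ m - u_ n)) (d *: e)) ->
  exists u, ucvg u_ u.
Proof.
move=> cauchy.
pose S := [set w | exists n0, forall m, (n0 <= m)%N -> vle w (u_ m)].
have near d : 0 < d -> exists n0, forall n, (n0 <= n)%N ->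
    S (u_ n - d *: e) /\ forall w, S w -> vle w (u_ n + d *: e).
  move=> /cauchy[n0 n0P]; exists n0 => n n0n; split.
    exists n0 => m n0m; rewrite vle_subl.
    by have [] := vabs_dist (n0P n m n0n n0m).
  move=> w [k kP]; apply: vle_trans (kP _ (leq_maxl k n0)) _.
  by have [] := vabs_dist (n0P _ n (leq_maxr k n0) n0n).
have [l supS] : exists l, is_supremum S l.
  have [n0 /(_ n0 (leqnn _))[Sn0 n0S]] := near 1 ltr01.
  by apply: hded; [exists (u_ n0 - 1 *: e)|exists (u_ n0 + 1 *: e)].
exists l => d /near[n0 n0P]; exists n0 => n /n0P[Sn nS]; have [Sl _] := supS.
apply: vabs_le => //.
  by rewrite vle_subl addrC; apply/(is_supremum_le _ supS).
by rewrite opprB vle_subl addrC -vle_subl; apply: Sl.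
Qed.

End LatticeLimits.
End Limits.

(** * Variation sums *)

Section VariationSums.
Context {R : realType} {X : orderedVectType R} {Y : absOrderUnitType R}.
Context {x y : X}.
Implicit Types (f g : vitv x y -> Y) (a b c z : vitv x y) (s : Y).

Lemma variation_sums_refl f a : variation_sums f a a 0.
Proof. by exists 0%N, (fun=> a); split; [split|rewrite big_ord0]. Qed.

(** The points [b] and [c] may coincide, although partitions are strict chains:
    the chain is then left alone and the added term is zero. This is what spares
    case distinctions everywhere below. *)
Lemma variation_sums_extend f a b c s : vle (val b) (val c) ->
  variation_sums f a b s -> variation_sums f a c (s + vabs (f c - f b)).
Proof.
move=> bc [n [t [[t0 tn tlt] ->]]].
have [<-|bneqc] := eqVneq b c.
  by exists n, t; split=> //; rewrite subrr vabs0 addr0.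
pose t' i := if (i <= n)%N then t i else c.
exists n.+1, t'; split; first split.
- by rewrite /t' leq0n.
- by rewrite /t' ltnn.
- move=> i; rewrite ltnS /t' => ile; rewrite ile.
  have [ilt|nle] := ltnP i n; first exact: tlt.
  have -> : i = n by apply/eqP; rewrite eqn_leq ile.
  by rewrite tn; split=> // /val_inj/eqP; apply/negP.
- rewrite big_ord_recr /= /t' leqnn ltnn tn; congr (_ + _).
  by apply: eq_bigr => i _; rewrite ltn_ord ltnW.
Qed.

Lemma variation_sums_step f a b : vle (val a) (val b) ->
  variation_sums f a b (vabs (f b - f a)).
Proof.
move=> ab; rewrite -[vabs _]add0r.
exact/variation_sums_extend/variation_sums_refl.
Qed.

(** For an increasing function the absolute values can be dropped, and the sum
    telescopes. *)
Lemma variation_sums_monotone f a b s :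
  (forall z1 z2, vle (val z1) (val z2) -> vle (f z1) (f z2)) ->
  variation_sums f a b s -> s = f b - f a.
Proof.
move=> mono [n [t [[<- <- tlt] ->]]].
rewrite -(telescope_sumr (fun i => f (t i)) (leq0n n)) big_mkord.
apply: eq_bigr => i _; apply: vabs_id; apply: mono.
by have [] := tlt i (ltn_ord i).
Qed.

(** The two sums on the right are taken along the chain of the left one. *)
Lemma variation_sumsD f g a b s : vector_lattice Y ->
  variation_sums (f + g) a b s ->
  exists sf sg, [/\ variation_sums f a b sf, variation_sums g a b sg &
                    vle s (sf + sg)].
Proof.
move=> hlat [n [t [pt ->]]].
exists (\sum_(i < n) vabs (f (t i.+1) - f (t i))).
exists (\sum_(i < n) vabs (g (t i.+1) - g (t i))).
split; [by exists n, t|by exists n, t|].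
rewrite -big_split; apply: vle_sum => i /=.
by rewrite opprD addrACA; apply: vabsD.
Qed.

Lemma variation_sumsZ (k : R) f a b s : variation_sums (k *: f) a b s ->
  exists2 sf, variation_sums f a b sf & s = `|k| *: sf.
Proof.
move=> [n [t [pt ->]]].
exists (\sum_(i < n) vabs (f (t i.+1) - f (t i))); first by exists n, t.
by rewrite scaler_sumr; apply: eq_bigr => i _; rewrite -vabsZ scalerBr.
Qed.

Lemma variationP f a b : bounded_variation f a b ->
  is_supremum (variation_sums f a b) (variation f a b).
Proof. by move=> bv; apply: (@xgetPex _ 0 _ bv). Qed.

End VariationSums.

(** * The bounded variation norm *)

Section BVNorm.
Context {R : realType} {X : orderedVectType R} {Y : absOrderUnitType R}.
Context {x y : X}.
Variable hxy : vle x y.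
Hypotheses (hlat : vector_lattice Y) (hded : dedekind_complete Y).
Implicit Types (f g : vitv x y -> Y) (z : vitv x y) (c d : R).
Local Notation e := (vunit : Y).
Local Notation x0 := (vitv_left hxy).
Local Notation y0 := (vitv_right hxy).
Local Notation BVxy := (BV hxy : set (vitv x y -> Y)).
Local Notation N := (normBV hxy : (vitv x y -> Y) -> R).

Lemma vitv_ge_left z : vle (val x0) (val z).
Proof. by case: z => z zP /=; have [] := set_mem zP. Qed.

Lemma vitv_le_right z : vle (val z) (val y0).
Proof. by case: z => z zP /=; have [] := set_mem zP. Qed.

(** The condition [N f <= c] with the supremum unfolded (see [normBVP]). It
    makes sense for every [f] and implies that [f] has bounded variation. *)
Definition normBV_le f c : Prop := forall s,
  variation_sums f x0 y0 s -> vle (vabs (f x0) + s) (c *: e).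

Lemma BV_bounded f v :
  (forall s, variation_sums f x0 y0 s -> vle s v) -> BVxy f.
Proof.
move=> fv; apply: hded; last by exists v.
by exists (vabs (f y0 - f x0)); apply: variation_sums_step.
Qed.

Lemma normBV_le_BV f c : normBV_le f c -> BVxy f.
Proof.
move=> fc; apply: (@BV_bounded _ (c *: e)) => s /fc; apply: vle_trans.
by rewrite addrC; apply: vle_addr; apply: vabs_pos.
Qed.

Lemma variation_pos f z : bounded_variation f x0 z -> vpos (variation f x0 z).
Proof.
move=> /variationP[ub _].
have fz := variation_sums_step f (vitv_ge_left z).
rewrite vposE; apply: vle_trans (ub _ fz); rewrite -vposE; exact: vabs_pos.
Qed.

Lemma normBVP f c : BVxy f -> 0 <= c -> N f <= c <-> normBV_le f c.
Proof.
move=> bvf c0; rewrite unorm_le //; last first.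
  by apply: vposD; [apply: vabs_pos|apply: variation_pos].
rewrite addrC -vle_subr (is_supremum_le _ (variationP bvf)).
by split=> fc s /fc; rewrite vle_subr addrC.
Qed.

Lemma normBV_ge0 f : 0 <= N f.
Proof. exact: order_unit_norm_ge0. Qed.

Lemma normBV_leN f : BVxy f -> normBV_le f (N f).
Proof. by move=> bvf; apply/normBVP => //; apply: normBV_ge0. Qed.

Lemma normBV_leD f g c d : normBV_le f c -> normBV_le g d ->
  normBV_le (f + g) (c + d).
Proof.
move=> fc gd s /(variation_sumsD hlat)[sf [sg [/fc fsf /gd gsg sle]]].
rewrite scalerDl; apply: vle_trans (vleD fsf gsg).
by rewrite addrACA; apply: vleD => //; apply: vabsD.
Qed.

Lemma normBV_leZ (k : R) f c : normBV_le f c -> normBV_le (k *: f) (`|k| * c).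
Proof.
move=> fc s /variation_sumsZ[sf /fc fsf ->].
by rewrite vabsZ -scalerDr -scalerA; apply: vleZ.
Qed.

(** Each condition [|f x| + s <= c e] involves finitely many values of [f], so
    it passes to pointwise limits by lower semicontinuity of the absolute value. *)
Lemma normBV_le_lim (f_ : nat -> vitv x y -> Y) f c :
  (forall z, ucvg (fun m => f_ m z) (f z)) ->
  (exists n0, forall m, (n0 <= m)%N -> normBV_le (f_ m) c) -> normBV_le f c.
Proof.
move=> ff [n0 fc] s [n [t [pt ->]]].
pose s_ m := \sum_(i < n) vabs (f_ m (t i.+1) - f_ m (t i)).
apply: (@le_liminf_le _ _ _ (fun m => vabs (f_ m x0) + s_ m)); last first.
  by exists n0 => m /fc; apply; exists n, t.
apply: le_liminfD; first exact: le_liminf_vabs.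
by apply: le_liminf_sum => i; apply: le_liminf_vabs => //; apply: ucvgB.
Qed.

(** The chain [x <= z <= y] contributes [|f z - f x|] to the variation, and
    [|f z| <= |f x| + |f z - f x|]. *)
Lemma normBV_le_value f c z : normBV_le f c -> vle (vabs (f z)) (c *: e).
Proof.
move=> fc; have := variation_sums_step f (vitv_ge_left z).
move=> /(variation_sums_extend (vitv_le_right z))/fc; apply: vle_trans.
rewrite addrA; apply: (vle_trans _ (vle_addr _ (vabs_pos _))).
by rewrite -[X in vabs X](subrKC (f x0)); apply: vabsD.
Qed.

Lemma BVD f g : BVxy f -> BVxy g -> BVxy (f + g).
Proof.
by move=> /normBV_leN Nf /normBV_leN Ng; apply: normBV_le_BV (normBV_leD Nf Ng).
Qed.

Lemma BVZ (k : R) f : BVxy f -> BVxy (k *: f).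
Proof. by move=> /normBV_leN Nf; exact: (normBV_le_BV (normBV_leZ Nf)). Qed.

Lemma BVB f g : BVxy f -> BVxy g -> BVxy (f - g).
Proof. by move=> bvf bvg; rewrite -scaleN1r; apply/BVD/BVZ. Qed.

Lemma BV_monotone f :
  (forall z1 z2, vle (val z1) (val z2) -> vle (f z1) (f z2)) -> BVxy f.
Proof.
move=> mono; apply: (@BV_bounded _ (f y0 - f x0)) => s.
by move=> /(variation_sums_monotone mono)->; apply: vle_refl.
Qed.

Lemma BV_cst v : BVxy (cst v).
Proof. by apply: BV_monotone => *; apply: vle_refl. Qed.

Lemma normBVD f g : BVxy f -> BVxy g -> N (f + g) <= N f + N g.
Proof.
move=> bvf bvg; apply/normBVP; [exact: BVD|by rewrite addr_ge0 ?normBV_ge0|].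
by apply: normBV_leD; apply: normBV_leN.
Qed.

Lemma normBVZ_le (k : R) f : BVxy f -> N (k *: f) <= `|k| * N f.
Proof.
move=> bvf; apply/normBVP; [exact: BVZ|by rewrite mulr_ge0 ?normBV_ge0|].
by apply/normBV_leZ/normBV_leN.
Qed.

(** The missing inequality is [normBVZ_le] for the scalar [1/k]. *)
Lemma normBVZ (k : R) f : BVxy f -> N (k *: f) = `|k| * N f.
Proof.
move=> bvf; apply/eqP; rewrite eq_le normBVZ_le //=.
have [->|k0] := eqVneq k 0; first by rewrite normr0 mul0r normBV_ge0.
rewrite -ler_pdivlMl ?normr_gt0 // -normfV.
by rewrite -{1}[f](scalerK k0); apply/normBVZ_le/BVZ.
Qed.

Lemma normBV_eq0 f : BVxy f -> N f = 0 -> f = 0.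
Proof.
move=> bvf Nf0; apply/funext => z; apply: vabs_le0.
by rewrite -(scale0r e) -Nf0; apply/normBV_le_value/normBV_leN.
Qed.

Lemma BV_normed_space : normed_space BVxy N.
Proof.
split; split.
- exact: (BV_cst 0).
- exact: BVD.
- exact: BVZ.
- by move=> f _; apply: normBV_ge0.
- exact: normBV_eq0.
- exact: normBVZ.
- exact: normBVD.
Qed.

(** The pointwise limit of a Cauchy sequence is its limit: the bound on
    [f_ n - f_ m] is kept while [m] goes to infinity with [n] fixed. *)
Lemma BV_complete : complete_space BVxy N.
Proof.
move=> f_ bvf cauchy.
have cauchy_le d : 0 < d -> exists n0, forall m n, (n0 <= m)%N -> (n0 <= n)%N ->
    normBV_le (f_ m - f_ n) d.
  move=> d0; have [n0 n0P] := cauchy d d0; exists n0 => m n n0m n0n.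
  by apply/normBVP; [apply: BVB|apply: ltW|apply/ltW/n0P].
have /choice[f ff] z : exists v, ucvg (fun m => f_ m z) v.
  apply: cauchy_ucvg => // d /cauchy_le[n0 n0P]; exists n0 => m n n0m n0n.
  exact: (normBV_le_value z (n0P m n n0m n0n)).
have fc d : 0 < d -> exists n0, forall n, (n0 <= n)%N -> normBV_le (f_ n - f) d.
  move=> /cauchy_le[n0 n0P]; exists n0 => n n0n.
  apply: (@normBV_le_lim (fun m => f_ n - f_ m)).
    by move=> z; apply: ucvgB => //; apply: ucvg_cst.
  by exists n0 => m; apply: n0P.
exists f.
  have [n0 /(_ n0 (leqnn _))/normBV_le_BV bvB] := fc 1 ltr01.
  by rewrite -[f](subKr (f_ n0)); apply: BVB.
move=> d d0; have d20 : 0 < d / 2 by rewrite divr_gt0.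
have [n0 n0P] := fc _ d20; exists n0 => n /n0P fn.
apply: (@le_lt_trans _ _ (d / 2)).
  by apply/normBVP => //; [apply: normBV_le_BV fn|apply: ltW].
by rewrite ltr_pdivrMr // ltr_pMr // ltr1n.
Qed.

(** * The variation function and the sup norm *)

(** A chain from [x] to [z] extends to [y], so its sum is below the total
    variation. *)
Lemma bounded_variation_left f z : BVxy f -> bounded_variation f x0 z.
Proof.
move=> [v [ub _]]; apply: hded.
  exists (vabs (f z - f x0)).
  by apply: variation_sums_step; apply: vitv_ge_left.
exists v => s /(variation_sums_extend (vitv_le_right z))/ub.
by apply: vle_trans; apply: vle_addr; apply: vabs_pos.
Qed.

Lemma abs_var_monotone f z1 z2 : BVxy f -> vle (val z1) (val z2) ->
  vle (abs_var hxy f z1) (abs_var hxy f z2).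
Proof.
move=> bvf z12; apply: vleD; first exact: vle_refl.
have [ub _] := variationP (bounded_variation_left z2 bvf).
apply/(is_supremum_le _ (variationP (bounded_variation_left z1 bvf))).
move=> s /(variation_sums_extend z12)/ub; apply: vle_trans.
by apply: vle_addr; apply: vabs_pos.
Qed.

Lemma abs_var_pos f z : BVxy f -> vpos (abs_var hxy f z).
Proof.
move=> bvf; apply: vposD; first exact: vabs_pos.
by apply: variation_pos; apply: bounded_variation_left.
Qed.

Lemma BV_abs_var f : BVxy f -> BVxy (abs_var hxy f).
Proof. by move=> bvf; apply: BV_monotone => *; apply: abs_var_monotone. Qed.

Lemma BVpos_cone : is_cone (BVpos hxy : set (vitv x y -> Y)).
Proof.
split.
- exists (cst 0); split=> [|z]; first exact: BV_cst.
  by rewrite vposE; apply: vle_refl.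
- by move=> f g [bvf f0] [bvg g0]; split=> [|z]; [apply: BVD|apply: vposD].
- by move=> k f k0 [bvf f0]; split=> [|z]; [apply: BVZ|apply: vposZ].
Qed.

(** Both sides are infima of one and the same set of scalars: as [abs_var] is
    positive and largest at [y], the bound at [y] implies all the others. *)
Lemma normBV_abs_var f : BVxy f -> N f = norm0 hxy (abs_var hxy f).
Proof.
move=> bvf; rewrite /normBV /norm0 /unorm /order_unit_norm.
congr inf; apply/seteqP; split=> c [c0 cD cB]; split=> //; last 2 first.
- by have [_ /(_ y0)] := cD.
- by have [_ /(_ y0)] := cB.
- split=> [|z].
    by apply: BVD; [apply: BVZ; apply: BV_cst|apply: BV_abs_var].
  apply: vposD; last exact: abs_var_pos.
  by apply: vposZ; [apply: ltW|apply: vunit_pos].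
- split=> [|z].
    by apply: BVB; [apply: BVZ; apply: BV_cst|apply: BV_abs_var].
  exact: vle_trans (abs_var_monotone bvf (vitv_le_right z)) cB.
Qed.

Lemma norm0_le f c : BVxy f -> 0 <= c ->
  (forall z, vle (vabs (f z)) (c *: e)) -> norm0 hxy f <= c.
Proof.
move=> bvf c0 fc; apply: order_unit_norm_le => //; first exact: BVpos_cone.
- by split=> [|z]; [apply: BV_cst|apply: vunit_pos].
- split=> [|z]; first by apply: BVD => //; apply: BVZ; apply: BV_cst.
  rewrite -[f in _ + f]opprK; apply: vle_trans (fc z); exact: vleN_vabs.
- split=> [|z]; first by apply: BVB => //; apply: BVZ; apply: BV_cst.
  apply: vle_trans (fc z); exact: vle_vabs.
Qed.

Lemma norm0_normBV f : BVxy f -> norm0 hxy f <= N f.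
Proof.
move=> bvf; apply: norm0_le => // [|z]; first exact: normBV_ge0.
exact/normBV_le_value/normBV_leN.
Qed.

Lemma normBV_mono f g : BVxy f -> BVxy g ->
  (forall z, vle (abs_var hxy f z) (abs_var hxy g z)) -> N f <= N g.
Proof.
move=> bvf bvg fg; apply/unorm_le; [exact: (abs_var_pos y0)|exact: normBV_ge0|].
apply: vle_trans (fg y0) _.
by apply/unorm_le; [exact: (abs_var_pos y0)|exact: normBV_ge0|].
Qed.

Lemma abs_var_le_normBV f z : BVxy f -> vle (abs_var hxy f z) (N f *: e).
Proof.
move=> bvf; apply: vle_trans (abs_var_monotone bvf (vitv_le_right z)) _.
by apply/unorm_le; [exact: (abs_var_pos y0)|exact: normBV_ge0|].
Qed.

Lemma norm0_dot_join_le f g : BVxy f -> BVxy g ->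
  norm0 hxy (dot_join hxy f g) <= N f + N g.
Proof.
move=> bvf bvg; have bvB := BVB bvf bvg; apply: norm0_le.
- by apply: BVZ; apply: BVD; [apply: BVD|apply: BV_abs_var].
- by rewrite addr_ge0 ?normBV_ge0.
move=> z; rewrite vabsZ ger0_norm ?invr_ge0 //.
(* The factor 1/2 of the join is matched by writing c e as 1/2 (c e + c e). *)
rewrite -[_ *: e](@scalerK _ _ 2) ?pnatr_eq0 //.
apply: vleZ; first by rewrite invr_ge0.
rewrite scaler_nat mulr2n; apply: vle_trans (vabsD hlat _ _) _; apply: vleD.
  rewrite scalerDl; apply: vle_trans (vabsD hlat _ _) _.
  by apply: vleD; apply/normBV_le_value/normBV_leN.
rewrite vabs_id; last exact: abs_var_pos.
apply: (vle_trans (abs_var_le_normBV z bvB)); apply: vle_unit.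
apply: le_trans (normBVD bvf _) _; first by rewrite -scaleN1r; apply: BVZ.
by rewrite -scaleN1r normBVZ // normrN1 mul1r.
Qed.

Lemma BVpos0_cone : is_cone (BVpos0 hxy : set (vitv x y -> Y)).
Proof.
have [[f0 Cf0] CD CZ] := BVpos_cone; split.
- exists (0 *: f0); split=> [|*]; first exact: CZ.
  by rewrite /= !scale0r; apply: vle_refl.
- move=> f g [fp fm] [gp gm]; split=> [|z1 z2 z12]; first exact: CD.
  by apply: vleD; [apply: fm|apply: gm].
- move=> k f k0 [fp fm]; split=> [|z1 z2 z12]; first exact: CZ.
  by apply: vleZ => //; apply: fm.
Qed.

End BVNorm.

Unset Implicit Arguments.

Theorem theorem4p8 (R : realType) (X : orderedVectType R) (x y : X)
    (hxy : vle x y) (Y : absOrderUnitType R)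
    (hlat : vector_lattice Y) (hded : dedekind_complete Y) :
  let BVxy : set (vitv x y -> Y) := BV hxy in
  let N : (vitv x y -> Y) -> R := normBV hxy in
  normed_space BVxy N /\
  (forall f, BVxy f -> N f = norm0 hxy (abs_var hxy f)) /\
  (forall f, BVxy f -> norm0 hxy f <= N f) /\
  (order_complete Y -> complete_space BVxy N) /\
  (forall f g, BVxy f -> BVxy g ->
     (forall z, vle (abs_var hxy f z) (abs_var hxy g z)) -> N f <= N g) /\
  (forall f g, BVpos hxy f -> BVpos hxy g ->
     norm0 hxy (dot_join hxy f g) <= N f + N g) /\
  ordered_normed_space BVxy N (BVpos0 hxy).
Proof.
move=> BVxy N; split; first exact: BV_normed_space.
split; first exact: normBV_abs_var.
split; first exact: norm0_normBV.
split; first by move=> _; apply: BV_complete.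
split; first exact: normBV_mono.
split; first by move=> f g [bvf _] [bvg _]; apply: norm0_dot_join_le.
split; [exact: BV_normed_space|by move=> f [[]]|exact: BVpos0_cone].
Qed.
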